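(* Let $(H;\langle\cdot,\cdot\rangle)$ be an inner product space over $\mathbb{K}$ ($\mathbb{K}=\mathbb{R}$ or $\mathbb{K}=\mathbb{C}$) and let $x,y,e\in H$ with $\|e\|=1$. If $r_1,r_2\in(0,1)$ and $$\|x-e\|\le r_1,\qquad\|y-e\|\le r_2,$$ then $$|\langle x,y\rangle-\langle x,e\rangle\langle e,y\rangle|\le r_1r_2\|x\|\,\|y\| .$$ The inequality is sharp in the sense that the constant $c=1$ in front of $r_1r_2$ cannot be replaced by a smaller constant.
   Context: The inner product is linear in its first argument and $\|z\|=\sqrt{\langle z,z\rangle}$. ''Cannot be replaced by a smaller constant'' means that no smaller constant makes the inequality valid for all inner product spaces over $\mathbb{K}$ and all data satisfying the hypotheses. *)

(* Defs.v *)
From HB Require Import structures.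
From mathcomp Require Import all_boot all_order all_algebra.
From mathcomp Require Import reals.
From mathcomp Require Import complex.

Set Implicit Arguments.
Unset Strict Implicit.
Unset Printing Implicit Defensive.

Import Order.TTheory GRing.Theory Num.Theory.
Local Open Scope ring_scope.

Inductive scalar_kind : Set := RealScalars | ComplexScalars.

Definition scalar_field (R : realType) (k : scalar_kind) : numFieldType :=
  match k with
  | RealScalars => R
  | ComplexScalars => R[i]
  end.

Definition scalar_conj (R : realType) (k : scalar_kind) :
    scalar_field R k -> scalar_field R k :=
  match k with
  | RealScalars => idfun
  | ComplexScalars => @Num.conj R[i]
  end.

Definition scalar_re (R : realType) (k : scalar_kind) : scalar_field R k -> R :=
  match k with
  | RealScalars => idfun
  | ComplexScalars => @complex.Re R
  end.

(* `|z| is an element of the scalar field itself; over R[i] it is a real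
   element, so its real part is the modulus as an element of R. *)
Definition modulus (R : realType) (k : scalar_kind) (z : scalar_field R k) : R :=
  scalar_re `|z|.

(* An inner product is a form in {dot H for conj}: positive definite,
   conj-symmetric, linear in its first argument and conj-semilinear in the
   second one.  ip z z is then real, and scalar_re only changes its type. *)
Definition ipnorm (R : realType) (k : scalar_kind)
    (H : lmodType (scalar_field R k))
    (ip : {dot H for @scalar_conj R k}) (z : H) : R :=
  Num.sqrt (scalar_re (ip z z)).

(* Main.v *)
Require Import Defs.
From HB Require Import structures.
From mathcomp Require Import all_boot all_order all_algebra.
From mathcomp Require Import reals.
From mathcomp Require Import complex.
From mathcomp Require Import ring lra.

(** Write x' = x - <x,e> e for the component of x orthogonal to the unit
    vector e.  Then <x,y> - <x,e><e,y> = <x',y'>, so by the Cauchy-Schwarz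
    inequality its modulus is at most the product of the norms of x' and y'
    ([dot_proj], [dot_CauchySchwarz]).  It is therefore enough to see that x'
    has norm at most r1 times that of x ([dnorm_proj_le]): expanding
    |x - e|^2 <= r1^2 bounds |<x,e>| below by (|x|^2 + 1 - r1^2) / 2, which by
    the arithmetic-geometric mean inequality is at least
    |x| sqrt(1 - r1^2), and |x'|^2 = |x|^2 - |<x,e>|^2.

    Both sides of the squared inequality are computed inside the scalar field
    K, where nonnegative elements can be compared whether K is real or complex
    ([dot_pre_gruss]); only the last step goes back to R, through the embedding
    [scalar_of_real].

    For the sharpness take x = y in the plane spanned by e and a unit vector f
    orthogonal to e.  Equality holds for x = (1 - r^2) e + r sqrt(1 - r^2) f,
    at distance r from e; r = 3/5 makes all coordinates rational. *)

Set Implicit Arguments.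
Unset Strict Implicit.
Unset Printing Implicit Defensive.

Import Order.TTheory GRing.Theory Num.Theory.
Local Open Scope ring_scope.

(** * The inequality over a number field with a conjugation *)

(** The identity of a real field and the conjugation of a complex one both
    satisfy the hypothesis on theta, which is what lets one proof serve the two
    kinds of scalars. *)
Section PreGruss.
Variables (K : numFieldType) (theta : K -> K).
Hypothesis mul_thetaK : forall z, z * theta z = `|z| ^+ 2.
Variables (H : lmodType K) (ip : {dot H for theta}).
Implicit Types (u v x y e : H) (rho : K).

Lemma dotC u v : ip u v = theta (ip v u).
Proof. by rewrite [LHS]hermitian_subproof mul1r. Qed.

Lemma mul_dotC u v : ip u v * ip v u = `|ip u v| ^+ 2.
Proof. by rewrite (dotC v) mul_thetaK. Qed.

Lemma normr_dotC u v : `|ip u v| = `|ip v u|.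
Proof. by apply/eqP; rewrite -(eqrXn2 (n := 2)) // -!mul_dotC mulrC. Qed.

Lemma dnorm_nneg u : 0 <= ip u u.
Proof.
have [->|/neq0_dnorm_gt0 /ltW //] := eqVneq u 0.
by rewrite linear0l.
Qed.

(** The vector <v,v> u - <u,v> v is a multiple of the component of u orthogonal
    to v; scaling by <v,v> avoids applying theta to a quotient. *)
Lemma dot_CauchySchwarz u v : `|ip u v| ^+ 2 <= ip u u * ip v v.
Proof.
have [->|v0] := eqVneq v 0; first by rewrite !linear0r normr0 expr0n mulr0.
have vv_gt0 : 0 < ip v v by apply: neq0_dnorm_gt0.
rewrite -subr_ge0 -(pmulr_rge0 _ vv_gt0) -mul_dotC.
suff -> : ip v v * (ip u u * ip v v - ip u v * ip v u) =
    ip (ip v v *: u - ip u v *: v) (ip v v *: u - ip u v *: v).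
  exact: dnorm_nneg.
rewrite !(linearBl, linearBr) !(linearZl_LR, linearZr_LR) /= -!dotC.
by ring.
Qed.

Definition proj_orth e x : H := x - ip x e *: e.

Lemma dot_proj e x y : ip e e = 1 ->
  ip (proj_orth e x) (proj_orth e y) = ip x y - ip x e * ip e y.
Proof.
move=> ee; rewrite /proj_orth !(linearBl, linearBr).
by rewrite !(linearZl_LR, linearZr_LR) /= -!dotC ee; ring.
Qed.

(** With rho = r^2 the squared distance bound reads
    |x|^2 + (1 - rho) <= 2 Re <x,e> <= 2 |<x,e>|.  Squaring it and using
    4 a b <= (a + b)^2 gives |x|^2 (1 - rho) <= |<x,e>|^2. *)
Lemma dnorm_proj_le e x rho : ip e e = 1 -> 0 <= rho <= 1 ->
  ip (x - e) (x - e) <= rho -> ip (proj_orth e x) (proj_orth e x) <= rho * ip x x.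
Proof.
move=> ee /andP[rho0 rho1] xe_le; rewrite dot_proj // mul_dotC.
have xx0 := dnorm_nneg x.
have expand : ip (x - e) (x - e) = ip x x + 1 - (ip x e + ip e x).
  by rewrite !(linearBl, linearBr) /= ee; ring.
(* Only real elements of K can be compared with their modulus. *)
have cross_real : ip x e + ip e x \is Num.real.
  rewrite (_ : _ + _ = ip x x + 1 - ip (x - e) (x - e)); last first.
    by rewrite expand; ring.
  by rewrite rpredB ?rpredD ?rpred1 ?ger0_real ?dnorm_nneg.
have cross_le : ip x e + ip e x <= `|ip x e| *+ 2.
  apply: le_trans (real_ler_norm cross_real) (le_trans (ler_normD _ _) _).
  by rewrite (normr_dotC e) mulr2n.
have sum_le : ip x x + (1 - rho) <= `|ip x e| *+ 2.
  apply: le_trans cross_le; rewrite -subr_ge0.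
  have := xe_le; rewrite expand -subr_ge0.
  by congr (0 <= _); ring.
have amgm : 4%:R * (ip x x * (1 - rho)) <= (ip x x + (1 - rho)) ^+ 2.
  rewrite -subr_ge0 (_ : _ - _ = (ip x x - (1 - rho)) ^+ 2); last by ring.
  by rewrite -realEsqr realB ?ger0_real ?subr_ge0.
have : 4%:R * (ip x x * (1 - rho)) <= 4%:R * `|ip x e| ^+ 2.
  apply: le_trans amgm _.
  rewrite (_ : 4%:R * _ = (`|ip x e| *+ 2) ^+ 2); last by ring.
  rewrite ler_pXn2r // nnegrE; last by apply: mulrn_wge0.
  by rewrite addr_ge0 ?subr_ge0.
rewrite ler_pM2l ?ltr0n // -subr_ge0 => h; rewrite -subr_ge0.
by move: h; congr (0 <= _); ring.
Qed.

Lemma dot_pre_gruss x y e rho1 rho2 :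
    ip e e = 1 -> 0 <= rho1 <= 1 -> 0 <= rho2 <= 1 ->
    ip (x - e) (x - e) <= rho1 -> ip (y - e) (y - e) <= rho2 ->
  `|ip x y - ip x e * ip e y| ^+ 2 <= (rho1 * ip x x) * (rho2 * ip y y).
Proof.
move=> ee r1 r2 xe ye; rewrite -dot_proj //.
apply: le_trans (dot_CauchySchwarz _ _) _.
by rewrite ler_pM ?dnorm_nneg ?dnorm_proj_le.
Qed.

End PreGruss.

(** * Real and complex scalars *)

(** Nonnegative scalars are exactly the images of nonnegative reals, so this
    order embedding transfers inequalities between K and R. *)
Definition scalar_of_real (R : realType) (k : scalar_kind) :
    {rmorphism R -> scalar_field R k} :=
  match k with
  | RealScalars => idfun
  | ComplexScalars => real_complex R
  end.

Section Scalars.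
Variables (R : realType) (k : scalar_kind).
Local Notation K := (scalar_field R k).
Local Notation emb := (scalar_of_real R k).

Lemma ler_scalar_of_real (a b : R) : (emb a <= emb b) = (a <= b).
Proof. by case: k => //=; apply: lecR. Qed.

Lemma scalar_of_realK : cancel emb (@scalar_re R k).
Proof. by case: k. Qed.

Lemma scalar_reK (z : K) : 0 <= z -> emb (scalar_re z) = z.
Proof. by case: k z => //= z /ger0_real /RRe_real. Qed.

Lemma scalar_re_ge0 (z : K) : 0 <= z -> 0 <= scalar_re z.
Proof. by move=> z0; rewrite -ler_scalar_of_real scalar_reK // rmorph0. Qed.

Lemma modulusK (z : K) : emb (modulus z) = `|z|.
Proof. exact: scalar_reK. Qed.

Lemma modulus_of_real (a : R) : 0 <= a -> modulus (emb a) = a.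
Proof.
move=> a0; rewrite /modulus ger0_norm ?scalar_of_realK //.
by rewrite -(rmorph0 emb) ler_scalar_of_real.
Qed.

Lemma mul_scalar_conj (z : K) : z * scalar_conj z = `|z| ^+ 2.
Proof.
case: k z => /= z; last by rewrite normCK.
by rewrite real_normK ?num_real.
Qed.

Lemma scalar_conj_of_real (a : R) : scalar_conj (emb a) = emb a.
Proof. by case: k => //=; apply/conj_Creal/complex_realP; exists a. Qed.

Lemma scalar_conjK : involutive (@scalar_conj R k).
Proof. by case: k => //=; apply: conjCK. Qed.

Lemma scalar_conj_is_zmod_morphism : zmod_morphism (@scalar_conj R k).
Proof. by case: k => //= a b; rewrite rmorphB. Qed.

Lemma scalar_conj_is_monoid_morphism : monoid_morphism (@scalar_conj R k).
Proof. by case: k => /=; split=> // [|a b]; rewrite ?rmorph1 ?rmorphM. Qed.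

Lemma ipnormK (H : lmodType K) (ip : {dot H for @scalar_conj R k}) (z : H) :
  emb (ipnorm ip z ^+ 2) = ip z z.
Proof.
have zz0 := dnorm_nneg ip z.
by rewrite sqr_sqrtr ?scalar_reK ?scalar_re_ge0.
Qed.

End Scalars.

HB.instance Definition _ (R : realType) (k : scalar_kind) :=
  GRing.isZmodMorphism.Build _ _ (@scalar_conj R k)
    (@scalar_conj_is_zmod_morphism R k).
HB.instance Definition _ (R : realType) (k : scalar_kind) :=
  GRing.isMonoidMorphism.Build _ _ (@scalar_conj R k)
    (@scalar_conj_is_monoid_morphism R k).

Lemma pre_gruss (R : realType) (k : scalar_kind) (H : lmodType (scalar_field R k))
    (ip : {dot H for @scalar_conj R k}) (x y e : H) (r1 r2 : R) :
  ipnorm ip e = 1 -> 0 <= r1 <= 1 -> 0 <= r2 <= 1 ->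
  ipnorm ip (x - e) <= r1 -> ipnorm ip (y - e) <= r2 ->
  modulus (ip x y - ip x e * ip e y) <= r1 * r2 * ipnorm ip x * ipnorm ip y.
Proof.
move=> e1 /andP[r1_ge0 r1_le1] /andP[r2_ge0 r2_le1] xe ye.
pose emb := scalar_of_real R k.
have ee : ip e e = 1 by rewrite -ipnormK e1 expr1n rmorph1.
have ball r u : 0 <= r -> ipnorm ip u <= r -> ip u u <= emb (r ^+ 2).
  by move=> r0 ur; rewrite -ipnormK ler_scalar_of_real ler_sqr ?nnegrE ?sqrtr_ge0.
have radius_sqr r : 0 <= r -> r <= 1 -> 0 <= emb (r ^+ 2) <= 1.
  move=> r_ge0 r_le1; rewrite -(rmorph0 emb) -(rmorph1 emb) !ler_scalar_of_real.
  by rewrite sqr_ge0 expr_le1.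
have := dot_pre_gruss (@mul_scalar_conj R k) ee (radius_sqr _ r1_ge0 r1_le1)
  (radius_sqr _ r2_ge0 r2_le1) (ball _ _ r1_ge0 xe) (ball _ _ r2_ge0 ye).
rewrite -modulusK -(ipnormK _ x) -(ipnormK _ y) -rmorphXn -!rmorphM.
rewrite ler_scalar_of_real -!exprMn ler_sqr ?nnegrE ?mulr_ge0 ?sqrtr_ge0 //.
  by congr (_ <= _); ring.
exact: scalar_re_ge0.
Qed.

(** * Equality in the coordinate plane *)

Section Coordinates.
Variables (R : realType) (k : scalar_kind) (n : nat).
Local Notation K := (scalar_field R k).
Implicit Types u v w : 'rV[K]_n.

Definition coord_dot u v : K := \sum_i u 0 i * scalar_conj (v 0 i).

Lemma coord_dot_zmodl v : zmod_morphism (coord_dot ^~ v).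
Proof.
by move=> u w; rewrite -sumrB; apply: eq_bigr => i _; rewrite !mxE mulrBl.
Qed.

Lemma coord_dot_zmodr u : zmod_morphism (coord_dot u).
Proof.
move=> v w; rewrite -sumrB; apply: eq_bigr => i _.
by rewrite !mxE rmorphB mulrBr.
Qed.

Lemma coord_dot_scalel v : scalable_for *%R (coord_dot ^~ v).
Proof.
by move=> a u; rewrite mulr_sumr; apply: eq_bigr => i _; rewrite mxE mulrA.
Qed.

Lemma coord_dot_scaler u :
  scalable_for (@scalar_conj R k \; *%R) (coord_dot u).
Proof.
move=> a v; rewrite /= mulr_sumr; apply: eq_bigr => i _.
by rewrite mxE rmorphM mulrCA.
Qed.

Lemma coord_dot_herm u v :
  coord_dot u v = (-1) ^+ false * scalar_conj (coord_dot v u).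
Proof.
rewrite mul1r rmorph_sum; apply: eq_bigr => i _.
by rewrite rmorphM /= scalar_conjK mulrC.
Qed.

Lemma coord_dot_gt0 u : u != 0 -> 0 < coord_dot u u.
Proof.
move=> /rV0Pn[i ui].
have ge0 j : 0 <= u 0 j * scalar_conj (u 0 j).
  by rewrite mul_scalar_conj exprn_ge0.
rewrite /coord_dot (bigD1 i) //= ltr_pwDl ?sumr_ge0 //.
by rewrite mul_scalar_conj exprn_gt0 ?normr_gt0.
Qed.

HB.instance Definition _ := isBilinear.Build K 'rV[K]_n 'rV[K]_n K
  *%R (@scalar_conj R k \; *%R) coord_dot
  coord_dot_zmodl coord_dot_zmodr coord_dot_scalel coord_dot_scaler.
HB.instance Definition _ := isHermitianSesquilinear.Build K 'rV[K]_n
  false (@scalar_conj R k) coord_dot coord_dot_herm.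
HB.instance Definition _ :=
  isDotProduct.Build K 'rV[K]_n coord_dot coord_dot_gt0.

End Coordinates.

Section Plane.
Variables (R : realType) (k : scalar_kind).
Local Notation K := (scalar_field R k).
Local Notation emb := (scalar_of_real R k).

Definition real_vec (a b : R) : 'rV[K]_2 := \row_(i < 2) emb [:: a; b]`_i.

Lemma dot_real_vec a b c d :
  coord_dot (real_vec a b) (real_vec c d) = emb (a * c + b * d).
Proof.
rewrite /coord_dot !big_ord_recl big_ord0 !mxE /= !scalar_conj_of_real.
by rewrite addr0 rmorphD !rmorphM.
Qed.

Lemma real_vecB a b c d : real_vec a b - real_vec c d = real_vec (a - c) (b - d).
Proof.
apply/rowP => i; rewrite !mxE -rmorphB.
by case: i => [[|[|]]].
Qed.

Definition plane_dot : {dot 'rV[K]_2 for @scalar_conj R k} := @coord_dot R k 2.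

Lemma ipnorm_real_vec a b r : 0 <= r -> a ^+ 2 + b ^+ 2 = r ^+ 2 ->
  ipnorm plane_dot (real_vec a b) = r.
Proof.
move=> r0 ab; rewrite /ipnorm /= dot_real_vec scalar_of_realK -!expr2 ab.
by rewrite sqrtr_sqr ger0_norm.
Qed.

End Plane.

Theorem theorem3 (R : realType) (k : scalar_kind) :
  (forall (H : lmodType (scalar_field R k)) (ip : {dot H for @scalar_conj R k})
          (x y e : H) (r1 r2 : R),
      ipnorm ip e = 1 ->
      0 < r1 < 1 -> 0 < r2 < 1 ->
      ipnorm ip (x - e) <= r1 ->
      ipnorm ip (y - e) <= r2 ->
      modulus (ip x y - ip x e * ip e y)
        <= r1 * r2 * ipnorm ip x * ipnorm ip y)
  /\
  (forall c : R, c < 1 ->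
    ~ (forall (H : lmodType (scalar_field R k)) (ip : {dot H for @scalar_conj R k})
              (x y e : H) (r1 r2 : R),
          ipnorm ip e = 1 ->
          0 < r1 < 1 -> 0 < r2 < 1 ->
          ipnorm ip (x - e) <= r1 ->
          ipnorm ip (y - e) <= r2 ->
          modulus (ip x y - ip x e * ip e y)
            <= c * (r1 * r2) * ipnorm ip x * ipnorm ip y)).
Proof.
split=> [H ip x y e r1 r2 e1 /andP[r1_gt0 r1_lt1] /andP[r2_gt0 r2_lt1]|c c1 le_c].
  by apply: pre_gruss; rewrite ?ltW.
(* With r = 3/5, the extremal vector (1 - r^2) e + r sqrt(1 - r^2) f has
   coordinates (16/25, 12/25) and norm 4/5. *)
pose e := real_vec k (1 : R) 0; pose x := real_vec k (16/25 : R) (12/25).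
have norm_e : ipnorm (plane_dot R k) e = 1.
  by apply: ipnorm_real_vec => //; lra.
have norm_x : ipnorm (plane_dot R k) x = 4/5.
  by apply: ipnorm_real_vec; lra.
have norm_xe : ipnorm (plane_dot R k) (x - e) = 3/5.
  by rewrite real_vecB; apply: ipnorm_real_vec; lra.
have r_bounds : 0 < (3/5 : R) < 1 by lra.
have := le_c _ (plane_dot R k) x x e _ _ norm_e r_bounds r_bounds.
rewrite norm_x norm_xe lexx => /(_ isT isT).
rewrite /= !dot_real_vec -rmorphM -rmorphB modulus_of_real; last by lra.
by lra.
Qed.
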